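(* There is an absolute constant $C>0$ such that the following holds. Let $\mathbf p=(p_1,\ldots,p_r)$ be an $r$-tuple of distinct primes and let $A\subset\mathbb{Z}$ be a finite set of the form \[A=\bigcup_{\mathbf v\in V}\mathbf p^{\mathbf v}B_{\mathbf v},\] where $V\subseteq\mathbb{N}_0^r$ is finite and each $B_{\mathbf v}$ is a finite set of integers coprime to $p_1\cdots p_r$. Then \[E_+(A,A)\ \le\ C^r\sum_{\mathbf v,\mathbf v'\in V}E_+\left(\mathbf p^{\mathbf v}B_{\mathbf v},\,\mathbf p^{\mathbf v'}B_{\mathbf v'}\right).\]
   Context: The additive energy of finite sets $X,Y$ is $E_+(X,Y)=|\{(x_1,x_2,y_1,y_2)\in X\times X\times Y\times Y: x_1+y_1=x_2+y_2\}|$. For $\mathbf v=(v_1,\ldots,v_r)$, $\mathbf p^{\mathbf v}=p_1^{v_1}\cdots p_r^{v_r}$, and $dX=\{dx:x\in X\}$. $\mathbb{N}_0$ denotes the non-negative integers. *)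

(* Defs.v *)
From mathcomp Require Import all_boot all_order all_algebra finmap reals.

Set Implicit Arguments.
Unset Strict Implicit.
Unset Printing Implicit Defensive.

Import Order.TTheory GRing.Theory Num.Theory.

Local Open Scope fset_scope.
Local Open Scope ring_scope.

Definition additive_energy (X Y : {fset int}) : nat :=
  #|` [fset q in X `*` X `*` Y `*` Y |
        let: (x1, x2, y1, y2) := q in (x1 + y1 == x2 + y2)%R] |%fset.

Definition dilate (d : int) (X : {fset int}) : {fset int} :=
  [fset (d * x)%R | x in X].

Definition monomial (r : nat) (p v : r.-tuple nat) : nat :=
  (\prod_(i < r) tnth p i ^ tnth v i)%N.

(* Main.v *)
Require Import Defs.
From mathcomp Require Import all_boot all_order all_algebra finmap reals.
From mathcomp Require Import zify.

Set Implicit Arguments.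
Unset Strict Implicit.
Unset Printing Implicit Defensive.

Import Order.TTheory GRing.Theory Num.Theory.

Local Open Scope fset_scope.
Local Open Scope ring_scope.

(**
The only arithmetic input is that, for a prime p, two of the four terms of a
solution of x1 + y1 = x2 + y2 in nonzero integers have the same p-adic
valuation: otherwise the least valuation would be attained once, and the
corresponding term could not be compensated by the other three
([logn_absz_coincidence]).

Fix a classification c of A, and let E(c) be the number of solutions of
x1 + y1 = x2 + y2 in A such that c x1 = c x2 and c y1 = c y2
([class_energy]).  The trivial classification gives the energy of A, and the
classification by all the valuations gives the double sum on the right-hand
side, because the vector of valuations of an element of A tells which
p^v B_v it comes from.  So it suffices to pay a constant factor for each
prime, namely to show E(c) <= 36 E(c, u) whenever every solution has a
coincidence for u among its four terms ([class_energy_refine]).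

The solutions counted by E(c) split into six families, according to which two
terms u identifies, and each family has size N with N^2 <= E(c) E(c, u); since
E(c) is at most the sum of the six sizes, E(c) <= 6 sqrt (E(c) E(c, u)), which is
the claim.  The bound on N is the Cauchy-Schwarz inequality: group the four
terms into two pairs, the first one being the pair which u identifies, and
rewrite the equation as an equality between a function of the first pair and a
function of the second.  The diagonal count of the second pairs is at most
E(c).  The diagonal count of the first pairs is immediately at most E(c, u) if
u identifies x1 with x2, or y1 with y2.  In the other cases it counts solutions
in which u identifies the four terms two by two, but along a pairing that is
not the one of c; a second use of Cauchy-Schwarz, along the third pairing of
the four terms, bounds it by E(c, u) ([leq_quads_match_side],
[leq_quads_match_cross]).
*)

(** * Cauchy-Schwarz for counting coincidences *)

Lemma sum_Cauchy (I : Type) (r : seq I) (a b : I -> nat) :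
  ((\sum_(i <- r) a i * b i) ^ 2
     <= (\sum_(i <- r) a i ^ 2) * (\sum_(i <- r) b i ^ 2))%N.
Proof.
rewrite -(leq_pmul2l (isT : 0 < 2)%N).
have -> : (2 * ((\sum_(i <- r) a i ^ 2) * (\sum_(i <- r) b i ^ 2)) =
   \sum_(i <- r) \sum_(j <- r) ((a i * b j) ^ 2 + (a j * b i) ^ 2))%N.
  under [RHS]eq_bigr do rewrite big_split.
  rewrite big_split /= [X in (_ + X)%N]exchange_big addnn -mul2n big_distrlr /=.
  by congr (2 * _)%N; apply: eq_bigr => i _; apply: eq_bigr => j _; rewrite expnMn.
rewrite -mulnn big_distrlr big_distrr leq_sum //= => i _.
rewrite big_distrr leq_sum //= => j _.
have [le_ij _] := nat_Cauchy (a i * b j)%N (a j * b i)%N.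
by apply: leq_trans le_ij; rewrite mulnACA [(b i * b j)%N]mulnC mulnACA.
Qed.

(** Both sides are sums over the values d of f and g: if a d and b d are
the sizes of the fibres, the three counts are the sums of a d * b d, of a d ^ 2
and of b d ^ 2. *)
Lemma card_Cauchy (S T : finType) (K : choiceType) (P : pred S) (Q : pred T)
    (f : S -> K) (g : T -> K) :
  (#|[set q : S * T | [&& P q.1, Q q.2 & f q.1 == g q.2]]| ^ 2
    <= #|[set q : S * S | [&& P q.1, P q.2 & f q.1 == f q.2]]|
       * #|[set q : T * T | [&& Q q.1, Q q.2 & g q.1 == g q.2]]|)%N.
Proof.
(* K may be infinite: only the values taken by f and g are summed over. *)
pose D := [fset f s | s in S] `|` [fset g t | t in T].
have fD s : f s \in D by rewrite inE; apply/orP; left; apply: in_imfset.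
have gD t : g t \in D by rewrite inE; apply/orP; right; apply: in_imfset.
have cardE (X Y : finType) (p : pred X) (q : pred Y) (h : X -> K) (k : Y -> K) :
    (forall x, h x \in D) ->
    #|[set z : X * Y | [&& p z.1, q z.2 & h z.1 == k z.2]]| =
    (\sum_(d <- D) #|[set x | p x & h x == d]| * #|[set y | q y & k y == d]|)%N.
  move=> hD; rewrite -sum1dep_card.
  rewrite -(pair_big_dep p (fun x y => q y && (h x == k y)) (fun _ _ => 1%N)) /=.
  under [RHS]eq_bigr => d _.
    rewrite -sum1dep_card big_distrl /= big_mkcondr /=. over.
  rewrite exchange_big; apply: eq_bigr => x _ /=.
  pose F d := #|[set y | q y & k y == d]|.
  have := @fbig_pred1_inj nat 0%N addn K K F id D (h x) (hD x) (@inj_id _).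
  rewrite sum1dep_card -big_mkcond => FE.
  transitivity (F (h x)); first by apply: eq_card => y; rewrite !inE eq_sym.
  by rewrite -FE; apply: eq_big => [d|d _]; rewrite ?mul1n // eq_sym.
rewrite !cardE //; exact: sum_Cauchy.
Qed.

(** * Additive quadruples and their energy relative to a classification *)

Section Quadruples.

Variables (T : finType) (G : zmodType) (phi : T -> G).

(** The coordinates follow the order used for the additive energy of X and Y: x1
and x2 stand for the elements of X, y1 and y2 for those of Y. *)
Definition quads (P : T -> T -> T -> T -> bool) : {set T * T * T * T} :=
  [set q | let: (x1, x2, y1, y2) := q in
           (phi x1 + phi y1 == phi x2 + phi y2) && P x1 x2 y1 y2].

Definition class_energy (K : eqType) (c : T -> K) : nat :=
  #|quads (fun x1 x2 y1 y2 => (c x1 == c x2) && (c y1 == c y2))|.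

Lemma leq_quads (P Q : T -> T -> T -> T -> bool) :
    (forall x1 x2 y1 y2, phi x1 + phi y1 = phi x2 + phi y2 ->
       P x1 x2 y1 y2 -> Q x1 x2 y1 y2) ->
  (#|quads P| <= #|quads Q|)%N.
Proof.
move=> PQ; apply/subset_leq_card/subsetP => -[[[x1 x2] y1] y2].
by rewrite !inE => /andP[/eqP e /PQ->//]; rewrite e eqxx.
Qed.

Lemma card_quads_swap (P : T -> T -> T -> T -> bool) :
  #|quads (fun x1 x2 y1 y2 => P x1 y2 y1 x2)| = #|quads P|.
Proof.
pose h (q : T * T * T * T) := let: (x1, x2, y1, y2) := q in (x1, y2, y1, x2).
have hK : involutive h by case=> [[[? ?] ?] ?].
rewrite -[LHS](card_preimset _ (inv_inj hK)); apply: eq_card => -[[[x1 x2] y1] y2].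
by rewrite !inE /= [phi y2 + _]addrC.
Qed.

(** The equation is read as an equality between the sums attached to the pairs
(x1, y1) and (x2, y2), to which P may add the equality of the keys f and g. *)
Lemma quads_Cauchy_sum (K : choiceType) (P : T -> T -> T -> T -> bool)
    (p q : rel T) (f g : T -> T -> K) :
    (forall x1 x2 y1 y2, P x1 x2 y1 y2 ->
       [&& p x1 y1, q x2 y2 & f x1 y1 == g x2 y2]) ->
  (#|quads P| ^ 2 <=
    #|quads (fun x1 x2 y1 y2 => [&& p x1 y1, p x2 y2 & f x1 y1 == f x2 y2])|
  * #|quads (fun x1 x2 y1 y2 => [&& q x1 y1, q x2 y2 & g x1 y1 == g x2 y2])|)%N.
Proof.
move=> PE.
pose key (k : T -> T -> K) z := (phi z.1 + phi z.2, k z.1 z.2).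
pose h (z : T * T * T * T) := let: (x1, x2, y1, y2) := z in ((x1, y1), (x2, y2)).
pose h' (z : T * T * (T * T)) := let: ((x1, y1), (x2, y2)) := z in (x1, x2, y1, y2).
have h_inj : injective h by apply: (can_inj (g := h')) => -[[[? ?] ?] ?].
have h'_inj : injective h' by apply: (can_inj (g := h)) => -[[? ?] [? ?]].
have le_sq (r : rel T) (k : T -> T -> K) :
    (#|[set z : (T * T) * (T * T) | [&& r z.1.1 z.1.2, r z.2.1 z.2.2 &
         key k z.1 == key k z.2]]| <=
     #|quads (fun x1 x2 y1 y2 => [&& r x1 y1, r x2 y2 & k x1 y1 == k x2 y2])|)%N.
  rewrite -(card_imset _ h'_inj); apply/subset_leq_card/subsetP => _ /imsetP[
    [[x1 y1] [x2 y2]] zP ->]; move: zP.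
  by rewrite !inE xpair_eqE /key /= => /and4P[-> -> -> ->].
apply: leq_trans (leq_mul (le_sq p f) (le_sq q g)).
apply: leq_trans (card_Cauchy (fun z => p z.1 z.2) (fun z => q z.1 z.2)
  (key f) (key g)).
rewrite leq_sqr -(card_imset _ h_inj); apply/subset_leq_card/subsetP => _ /imsetP[
    [[[x1 x2] y1] y2] zP ->]; move: zP.
by rewrite !inE /= xpair_eqE /= => /andP[-> /PE/and3P[-> -> ->]].
Qed.

(** The equation is read as x1 - y2 = x2 - y1.  The third way to pair the terms,
(x1, x2) with (y2, y1), reduces to this one by exchanging x2 and y2. *)
Lemma quads_Cauchy_diff (K : choiceType) (P : T -> T -> T -> T -> bool)
    (p q : rel T) (f g : T -> T -> K) :
    (forall x1 x2 y1 y2, P x1 x2 y1 y2 ->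
       [&& p x1 y2, q x2 y1 & f x1 y2 == g x2 y1]) ->
  (#|quads P| ^ 2 <=
    #|quads (fun x1 x2 y1 y2 => [&& p x1 y2, p x2 y1 & f x1 y2 == f x2 y1])|
  * #|quads (fun x1 x2 y1 y2 => [&& q x1 y2, q x2 y1 & g x1 y2 == g x2 y1])|)%N.
Proof.
move=> PE.
pose key (k : T -> T -> K) z := (phi z.1 - phi z.2, k z.1 z.2).
pose h (z : T * T * T * T) := let: (x1, x2, y1, y2) := z in ((x1, y2), (x2, y1)).
pose h' (z : T * T * (T * T)) := let: ((x1, y2), (x2, y1)) := z in (x1, x2, y1, y2).
have h_inj : injective h by apply: (can_inj (g := h')) => -[[[? ?] ?] ?].
have h'_inj : injective h' by apply: (can_inj (g := h)) => -[[? ?] [? ?]].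
have subE (a b d e : T) :
    (phi a - phi b == phi d - phi e) = (phi a + phi e == phi d + phi b).
  by rewrite subr_eq addrAC eq_sym subr_eq eq_sym.
have le_sq (r : rel T) (k : T -> T -> K) :
    (#|[set z : (T * T) * (T * T) | [&& r z.1.1 z.1.2, r z.2.1 z.2.2 &
         key k z.1 == key k z.2]]| <=
     #|quads (fun x1 x2 y1 y2 => [&& r x1 y2, r x2 y1 & k x1 y2 == k x2 y1])|)%N.
  rewrite -(card_imset _ h'_inj); apply/subset_leq_card/subsetP => _ /imsetP[
    [[x1 y2] [x2 y1]] zP ->]; move: zP.
  by rewrite !inE xpair_eqE /key /= subE => /and4P[-> -> -> ->].
apply: leq_trans (leq_mul (le_sq p f) (le_sq q g)).
apply: leq_trans (card_Cauchy (fun z => p z.1 z.2) (fun z => q z.1 z.2)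
  (key f) (key g)).
rewrite leq_sqr -(card_imset _ h_inj); apply/subset_leq_card/subsetP => _ /imsetP[
    [[[x1 x2] y1] y2] zP ->]; move: zP.
by rewrite !inE /= xpair_eqE /= subE => /andP[-> /PE/and3P[-> -> ->]].
Qed.

(** * Refining a classification *)

Section Refine.

Variables (K L : choiceType) (c : T -> K) (u : T -> L).

Let cu x := (c x, u x).

Let same (x1 x2 y1 y2 : T) := (c x1 == c x2) && (c y1 == c y2).

(** Here c pairs x1 with x2 while u pairs x1 with y1, so that in
neither of these pairings do c and u match the same terms.  Along the remaining pairing, x1 with y2 and
x2 with y1, all of the four classes involved are determined by either pair:
the class of u at x1 is known from y1, the one at y2 from x2, and the classes
of c likewise.  Both diagonal counts are then at most E(c, u). *)
Lemma leq_quads_match_side :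
  (#|quads (fun x1 x2 y1 y2 =>
       [&& same x1 x2 y1 y2, u x1 == u y1 & u x2 == u y2])|
     <= class_energy cu)%N.
Proof.
rewrite -leq_sqr -[leqRHS]mulnn.
pose f x y := (cu x, cu y); pose g x y := ((c x, u y), (c y, u x)).
apply: leq_trans (quads_Cauchy_diff (p := fun _ _ => true) (q := fun _ _ => true)
  (f := f) (g := g) _) _.
- move=> x1 x2 y1 y2; rewrite /same /f /g /cu /= !xpair_eqE.
  by move=> /and3P[/andP[-> /eqP->] -> /eqP->]; rewrite !eqxx.
apply: leq_mul; apply: leq_quads => x1 x2 y1 y2 _; rewrite /f /g /cu /= !xpair_eqE.
- by move=> /andP[/andP[-> ->] /andP[/eqP-> /eqP->]]; rewrite !eqxx.
- by move=> /andP[/andP[-> /eqP->] /andP[/eqP-> /eqP->]]; rewrite !eqxx.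
Qed.

(** The same argument where u pairs x1 with y2; the remaining pairing is now x1
with y1 and x2 with y2. *)
Lemma leq_quads_match_cross :
  (#|quads (fun x1 x2 y1 y2 =>
       [&& same x1 x2 y1 y2, u x1 == u y2 & u x2 == u y1])|
     <= class_energy cu)%N.
Proof.
rewrite -leq_sqr -[leqRHS]mulnn.
pose f x y := (cu x, cu y); pose g x y := ((c x, u y), (c y, u x)).
apply: leq_trans (quads_Cauchy_sum (p := fun _ _ => true) (q := fun _ _ => true)
  (f := f) (g := g) _) _.
- move=> x1 x2 y1 y2; rewrite /same /f /g /cu /= !xpair_eqE.
  by move=> /and3P[/andP[-> /eqP->] -> /eqP->]; rewrite !eqxx.
apply: leq_mul; apply: leq_quads => x1 x2 y1 y2 _; rewrite /f /g /cu /= !xpair_eqE.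
- by move=> /andP[/andP[-> ->] /andP[/eqP-> /eqP->]]; rewrite !eqxx.
- by move=> /andP[/andP[-> /eqP->] /andP[/eqP-> /eqP->]]; rewrite !eqxx.
Qed.

Let coinc (R : T -> T -> T -> T -> bool) :=
  #|quads (fun x1 x2 y1 y2 => same x1 x2 y1 y2 && R x1 x2 y1 y2)|.

(** When u identifies two terms which c identifies already, one of the pairs
(x1, x2), (y1, y2) is as in E(c, u) and the other one as in E(c).  In this lemma and
the next two, b tells which of the two pairs the coincidence occurs in. *)
Lemma coinc_parallel (b : bool) :
  (coinc (fun x1 x2 y1 y2 => if b then u x1 == u x2 else u y1 == u y2) ^ 2
     <= class_energy c * class_energy cu)%N.
Proof.
rewrite /coinc -card_quads_swap.
pose p b x y := (c x == c y) && (b ==> (u x == u y)).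
apply: leq_trans (quads_Cauchy_diff (p := p b) (q := p (~~ b))
  (f := fun _ _ => tt) (g := fun _ _ => tt) _) _.
- move=> x1 x2 y1 y2; rewrite /same /p; case: b => /= /andP[/andP[-> /eqP->] ];
  by rewrite !eqxx //= eq_sym => ->.
have le_p b' : (#|quads (fun x1 x2 y1 y2 => [&& p b' x1 y2, p b' x2 y1 & tt == tt])|
    <= if b' then class_energy cu else class_energy c)%N.
  rewrite -card_quads_swap; case: b'; apply: leq_quads => x1 x2 y1 y2 _;
  rewrite /p /cu ?xpair_eqE andbT /=.
    by move=> /andP[/andP[-> ->] /andP[/eqP-> /eqP->]]; rewrite !eqxx.
  by rewrite !andbT => /andP[-> /eqP->] /=.
apply: leq_trans (leq_mul (le_p b) (le_p (~~ b))) _.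
by case: b => //=; rewrite mulnC.
Qed.

(** The keys (c x1, c y1) and (c x2, c y2) remember that c matches the two sides
of the equation.  The diagonal count of the pairs identified by u is
bounded by [leq_quads_match_side]. *)
Lemma coinc_side (b : bool) :
  (coinc (fun x1 x2 y1 y2 => if b then u x1 == u y1 else u x2 == u y2) ^ 2
     <= class_energy c * class_energy cu)%N.
Proof.
rewrite /coinc.
pose p b x y := b ==> (u x == u y); pose f x y := (c x, c y).
apply: leq_trans (quads_Cauchy_sum (p := p b) (q := p (~~ b))
  (f := f) (g := f) _) _.
- move=> x1 x2 y1 y2; rewrite /same /p /f xpair_eqE.
  by case: b => /= /andP[/andP[-> ->] ->].
have le_p b' : (#|quads (fun x1 x2 y1 y2 => [&& p b' x1 y1, p b' x2 y2 & f x1 y1 == f x2 y2])|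
    <= if b' then class_energy cu else class_energy c)%N.
  case: b'; last by apply: leq_quads => x1 x2 y1 y2 _ /=.
  apply: leq_trans leq_quads_match_side; apply: leq_quads => x1 x2 y1 y2 _ /=.
  by rewrite /p /f xpair_eqE /same /= => /and3P[-> -> ->].
apply: leq_trans (leq_mul (le_p b) (le_p (~~ b))) _.
by case: b => //=; rewrite mulnC.
Qed.

Lemma coinc_cross (b : bool) :
  (coinc (fun x1 x2 y1 y2 => if b then u x1 == u y2 else u x2 == u y1) ^ 2
     <= class_energy c * class_energy cu)%N.
Proof.
rewrite /coinc.
pose p b x y := b ==> (u x == u y); pose f x y := (c x, c y).
apply: leq_trans (quads_Cauchy_diff (p := p b) (q := p (~~ b))
  (f := f) (g := f) _) _.
- move=> x1 x2 y1 y2; rewrite /same /p /f xpair_eqE.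
  by case: b => /= /andP[/andP[-> /eqP->] ->]; rewrite eqxx.
have le_p b' : (#|quads (fun x1 x2 y1 y2 => [&& p b' x1 y2, p b' x2 y1 & f x1 y2 == f x2 y1])|
    <= if b' then class_energy cu else class_energy c)%N.
  case: b'; last first.
    apply: leq_quads => x1 x2 y1 y2 _ /=.
    by rewrite /f xpair_eqE => /andP[-> /eqP->] /=.
  apply: leq_trans leq_quads_match_cross; apply: leq_quads => x1 x2 y1 y2 _ /=.
  by rewrite /p /f xpair_eqE /same /= => /and3P[-> -> /andP[-> /eqP->]]; rewrite eqxx.
apply: leq_trans (leq_mul (le_p b) (le_p (~~ b))) _.
by case: b => //=; rewrite mulnC.
Qed.

Hypothesis coincidence : forall x1 x2 y1 y2,
  phi x1 + phi y1 = phi x2 + phi y2 ->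
  [|| u x1 == u x2, u y1 == u y2, u x1 == u y1, u x2 == u y2,
      u x1 == u y2 | u x2 == u y1].

Lemma class_energy_refine : (class_energy c <= 36 * class_energy cu)%N.
Proof.
pose Q R := quads (fun x1 x2 y1 y2 => same x1 x2 y1 y2 && R x1 x2 y1 y2).
pose Qx b := Q (fun x1 x2 y1 y2 => if b then u x1 == u x2 else u y1 == u y2).
pose Qs b := Q (fun x1 x2 y1 y2 => if b then u x1 == u y1 else u x2 == u y2).
pose Qc b := Q (fun x1 x2 y1 y2 => if b then u x1 == u y2 else u x2 == u y1).
have cover : (class_energy c <= #|Qx true| + #|Qx false| + #|Qs true| + #|Qs false|
                + #|Qc true| + #|Qc false|)%N.
  apply: (@leq_trans #|Qx true :|: Qx false :|: Qs true :|: Qs false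
                         :|: Qc true :|: Qc false|); last first.
    by do 4![apply: leq_trans (leq_card_setU _ _) _; rewrite leq_add2r];
       exact: leq_card_setU.
  apply/subset_leq_card/subsetP => -[[[x1 x2] y1] y2]; rewrite !inE /same.
  case/andP=> /eqP e ->; rewrite e eqxx /=.
  by rewrite -!orbA; apply: coincidence.
(* Otherwise each of the six families has fewer than E(c) / 6 elements. *)
rewrite leqNgt; apply/negP => small.
have bound N : (N ^ 2 <= class_energy c * class_energy cu -> 6 * N < class_energy c)%N.
  move=> leN; rewrite -ltn_sqr expnMn -[ltnRHS]mulnn; nia.
have bx b : (6 * #|Qx b| < class_energy c)%N := bound _ (coinc_parallel b).
have bs b : (6 * #|Qs b| < class_energy c)%N := bound _ (coinc_side b).
have bc b : (6 * #|Qc b| < class_energy c)%N := bound _ (coinc_cross b).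
move: (bx true) (bx false) (bs true) (bs false) (bc true) (bc false) cover.
lia.
Qed.

End Refine.

Lemma class_energy_refine_seq (I : Type) (L : choiceType) (u : I -> T -> L)
    (s : seq I) :
    (forall i x1 x2 y1 y2, phi x1 + phi y1 = phi x2 + phi y2 ->
       [|| u i x1 == u i x2, u i y1 == u i y2, u i x1 == u i y1,
           u i x2 == u i y2, u i x1 == u i y2 | u i x2 == u i y1]) ->
  (class_energy (fun _ => tt)
     <= 36 ^ size s * class_energy (fun x => [seq u i x | i <- s]))%N.
Proof.
move=> coinc_u; elim: s => [|i s IHs].
  by rewrite mul1n; apply: leq_quads.
apply: (leq_trans IHs); rewrite expnSr -mulnA leq_mul2l; apply/orP; right.
apply: leq_trans (class_energy_refine _ (coinc_u i)) _.
rewrite leq_mul2l; apply: leq_quads => x1 x2 y1 y2 _ /=.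
by rewrite !xpair_eqE !eqseq_cons [(u i x1 == _) && _]andbC [(u i y1 == _) && _]andbC.
Qed.

End Quadruples.

(** * Valuations of the terms of an additive quadruple *)

Lemma lt_logn_absz (p k : nat) (x : int) :
  prime p -> x != 0 -> (k < logn p `|x|)%N = (p%:Z ^+ k.+1 %| x)%Z.
Proof.
by move=> pr_p x0; rewrite dvdzE abszX pfactor_dvdn // lt0n absz_eq0.
Qed.

(** Otherwise a, b and c would all be divisible by a power of p which does not
divide x. *)
Lemma logn_absz_sum3 (p : nat) (x a b c : int) : prime p ->
    x != 0 -> a != 0 -> b != 0 -> c != 0 -> x = a + b + c ->
  ~~ [&& logn p `|x| < logn p `|a|, logn p `|x| < logn p `|b|
       & logn p `|x| < logn p `|c|]%N.
Proof.
move=> pr_p x0 a0 b0 c0 xE; apply/negP.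
rewrite !lt_logn_absz // => /and3P[pa pb pc].
have := rpredD (rpredD pa pb) pc.
by rewrite -xE -lt_logn_absz // ltnn.
Qed.

(** If the four valuations were distinct, the term with the least one would be
a signed sum of the three others, against [logn_absz_sum3]. *)
Lemma logn_absz_coincidence (p : nat) (x1 x2 y1 y2 : int) : prime p ->
    x1 != 0 -> x2 != 0 -> y1 != 0 -> y2 != 0 -> x1 + y1 = x2 + y2 ->
  let u z := logn p `|z| in
  [|| u x1 == u x2, u y1 == u y2, u x1 == u y1, u x2 == u y2,
      u x1 == u y2 | u x2 == u y1].
Proof.
move=> pr_p x10 x20 y10 y20 e; set u := (fun z => _); rewrite /=.
have uN (z : int) : logn p `|- z|%N = u z by rewrite abszN.
have nz (z : int) : z != 0 -> - z != 0 by rewrite oppr_eq0.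
have e1 : x1 = x2 + y2 + - y1 by rewrite -e addrK.
have e2 : y1 = x2 + y2 + - x1 by rewrite -e addrC addKr.
have e3 : x2 = x1 + y1 + - y2 by rewrite e addrK.
have e4 : y2 = x1 + y1 + - x2 by rewrite e addrC addKr.
have := logn_absz_sum3 pr_p x10 x20 y20 (nz _ y10) e1.
have := logn_absz_sum3 pr_p y10 x20 y20 (nz _ x10) e2.
have := logn_absz_sum3 pr_p x20 x10 y10 (nz _ y20) e3.
have := logn_absz_sum3 pr_p y20 x10 y10 (nz _ x20) e4.
rewrite !uN -!/(u _) => h4 h3 h2 h1.
move: (u x1) (u x2) (u y1) (u y2) h1 h2 h3 h4 => a b c d; lia.
Qed.

Lemma logn_monomial (r : nat) (p v : r.-tuple nat) (i : 'I_r) :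
    (forall j, prime (tnth p j)) -> uniq p ->
  logn (tnth p i) (monomial p v) = tnth v i.
Proof.
move=> pr_p uniq_p; rewrite /monomial.
rewrite (bigD1 i) //= mulnC logn_Gauss ?pfactorK //.
apply: (big_ind (coprime (tnth p i))) => [|m n com con|j ji].
- exact: coprimen1.
- by rewrite coprimeMr com.
- rewrite coprimeXr // prime_coprime // dvdn_prime2 //.
  by apply: contra ji => /eqP/(tuple_uniqP _ uniq_p)->.
Qed.

Lemma logn_dilate (r : nat) (p v : r.-tuple nat) (X : {fset int}) (x : int) :
    (forall j, prime (tnth p j)) -> uniq p ->
    (forall b, b \in X -> coprimez b (\prod_(i < r) tnth p i)%N) ->
    x \in dilate (monomial p v) X ->
  forall i : 'I_r, x != 0 /\ logn (tnth p i) `|x| = tnth v i.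
Proof.
move=> pr_p uniq_p copX /imfsetP[b /= /copX cop_b ->] i.
have cop_i : coprime (tnth p i) `|b|.
  move: cop_b; rewrite coprimezE /= (bigD1 i) //= coprimeMr => /andP[+ _].
  by rewrite coprime_sym.
have b0 : b != 0.
  apply: contraL cop_i => /eqP->; rewrite /coprime gcdn0.
  by have := prime_gt1 (pr_p i); case: (tnth p i) => [|[]].
have m0 : (0 < monomial p v)%N.
  by apply: prodn_gt0 => j; rewrite expn_gt0 prime_gt0.
split; first by rewrite mulf_neq0 // eqz_nat -lt0n.
by rewrite abszM mulnC logn_Gauss // logn_monomial.
Qed.

(** * Classified energy and the energies of the classes *)

Lemma leq_card_bigfcup (I : Type) (K : choiceType) (s : seq I) (F : I -> {fset K}) :
  (#|` \bigcup_(i <- s) F i| <= \sum_(i <- s) #|` F i|)%N.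
Proof.
elim: s => [|i s IHs]; first by rewrite !big_nil cardfs0.
rewrite !big_cons; apply: leq_trans (leq_card_fsetU _ _) _.
by rewrite leq_add2l.
Qed.

Lemma leq_additive_energy_class (A : {fset int}) :
  (additive_energy A A <= class_energy (fun x : A => val x) (fun _ => tt))%N.
Proof.
pose h (q : A * A * A * A) :=
  let: (x1, x2, y1, y2) := q in (val x1, val x2, val y1, val y2).
rewrite /class_energy cardE -(size_map h).
apply: (@uniq_leq_size _ (enum_fset _)); first exact: fset_uniq.
move=> [[[x1 x2] y1] y2] /imfsetP[[[[a b] d] e]] /=.
rewrite !inE /= => /andP[/andP[/andP[/andP[Aa Ab] Ad] Ae] ade] [-> -> -> ->].
apply/mapP; exists ([` Aa], [` Ab], [` Ad], [` Ae])%fset => //.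
by rewrite mem_enum inE /= ade.
Qed.

(** If the classes of c are finer than the pieces F v, then the piece of x1 also
contains x2 and the piece of y1 also contains y2, so the quadruple is
counted in the energy of these two pieces; a union bound over the pairs of
pieces concludes. *)
Lemma leq_class_energy_cover (V K : choiceType) (S : {fset V}) (A : {fset int})
    (F : V -> {fset int}) (c : A -> K) :
    (forall x : A, exists2 v, v \in S & val x \in F v) ->
    (forall (x y : A) v, v \in S -> val x \in F v -> c x = c y -> val y \in F v) ->
  (class_energy (fun x : A => val x) c
     <= \sum_(v <- S) \sum_(v' <- S) additive_energy (F v) (F v'))%N.
Proof.
move=> inF cF.
pose D v v' := [fset q in F v `*` F v `*` F v' `*` F v' |
        let: (x1, x2, y1, y2) := q in (x1 + y1 == x2 + y2)%R].
pose h (q : A * A * A * A) :=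
  let: (x1, x2, y1, y2) := q in (val x1, val x2, val y1, val y2).
have h_inj : injective h.
  by move=> [[[? ?] ?] ?] [[[? ?] ?] ?] [] /val_inj-> /val_inj-> /val_inj-> /val_inj->.
apply: (@leq_trans #|` \bigcup_(v <- S) \bigcup_(v' <- S) D v v'|); last first.
  apply: leq_trans (leq_card_bigfcup _ _) _; apply: leq_sum => v _.
  exact: leq_card_bigfcup.
rewrite /class_energy cardE -(size_map h).
apply: uniq_leq_size; first by rewrite map_inj_uniq // enum_uniq.
move=> _ /mapP[[[[x1 x2] y1] y2]] + ->.
rewrite mem_enum inE => /and3P[e /eqP cx /eqP cy].
have [[v vS x1F] [v' v'S y1F]] := (inF x1, inF y1).
apply/bigfcupP; exists v; rewrite ?vS //.
apply/bigfcupP; exists v'; rewrite ?v'S //.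
by rewrite !inE /= x1F y1F (cF x1 x2) // (cF y1 y2).
Qed.

Theorem corollary5p2 (R : realType) :
  exists C : R, 0 < C /\
    forall (r : nat) (p : r.-tuple nat)
           (V : {fset r.-tuple nat}) (B : r.-tuple nat -> {fset int})
           (A : {fset int}),
      (forall i : 'I_r, prime (tnth p i)) ->
      uniq p ->
      (forall v b, v \in V -> b \in B v ->
         coprimez b (\prod_(i < r) tnth p i)%N) ->
      A = \bigcup_(v <- V) dilate (monomial p v) (B v) ->
      (additive_energy A A)%:R <=
        C ^+ r * (\sum_(v <- V) \sum_(v' <- V)
                    additive_energy (dilate (monomial p v) (B v))
                                    (dilate (monomial p v') (B v')))%N%:R.
Proof.
exists 36; split=> // r p V B A pr_p uniq_p copB AE.
rewrite -natrX -natrM ler_nat.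
pose u (i : 'I_r) (x : A) := logn (tnth p i) `|val x|.
have inV (x : A) : exists2 v, v \in V & val x \in dilate (monomial p v) (B v).
  have: val x \in \bigcup_(v <- V) dilate (monomial p v) (B v).
    by rewrite -AE; apply: valP.
  by case/bigfcupP=> v; rewrite andbT => vV xv; exists v.
have uE v (x : A) : v \in V -> val x \in dilate (monomial p v) (B v) ->
    forall i, val x != 0 /\ u i x = tnth v i.
  by move=> vV; apply: logn_dilate => // b; apply: copB.
(* For r = 0 the set A may contain 0, so that an index is needed. *)
have nz (i : 'I_r) (x : A) : val x != 0.
  by have [v vV /uE-/(_ vV i)[]] := inV x.
apply: leq_trans (leq_additive_energy_class A) _.
apply: leq_trans (class_energy_refine_seq (u := u) (enum 'I_r) _) _.
  by move=> i x1 x2 y1 y2; apply: logn_absz_coincidence => //; apply: nz i _.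
rewrite size_enum_ord leq_mul2l; apply/orP; right.
apply: (leq_class_energy_cover inV) => x y v vV xv cxy.
have [v' v'V yv'] := inV y.
suff -> : v = v' by [].
apply: eq_from_tnth => i.
have [_ <-] := uE _ _ vV xv i; have [_ <-] := uE _ _ v'V yv' i.
by move/eq_in_map: cxy => ->; rewrite ?mem_enum.
Qed.
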